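(* Let $\mathcal H$ be a real Hilbert space, $I=\{1,\dots,m\}$ with $m\ge 1$, let $T_i\colon\mathcal H\to\mathcal H$, $i\in I$, be cutters, put $C_i:=\operatorname{Fix}T_i$ and $C:=\bigcap_{i\in I}C_i$, and let $Q\subset\mathcal H$ be closed and convex. Let $\{x_k\}_{k=0}^\infty$ be defined by $$x_0\in Q,\qquad x_{k+1}:=P_Q\Big(x_k+\alpha_k\sum_{i\in I_k}\lambda_{i,k}\,\beta_{i,k}(x_k)\big(T_i(x_k)-x_k\big)\Big),$$ where $\beta_{i,k}(x):=\dfrac{\frac{r_k}{\varphi_i(x)}+\|T_i(x)-x\|}{\|T_i(x)-x\|}$ if $T_i(x)\ne x$ and $\beta_{i,k}(x):=0$ otherwise, with $r_k\in(0,\infty)$, $\varphi_i\colon\mathcal H\to(0,\infty)$, $\alpha_k\in(0,2)$, $\emptyset\neq I_k\subset I$, $\lambda_{i,k}\in(0,1]$ and $\sum_{i\in I_k}\lambda_{i,k}=1$. Assume that: (i) $C\cap Q\neq\emptyset$. (ii) $\sum_{k=0}^\infty r_k<\infty$. (iii) For each bounded subset $S\subset\mathcal H$ there are $\delta,\Delta>0$ such that $\delta\le\varphi_i(x)\le\Delta$ for all $x\in S$ and all $i\in I$. (iv) There is $\varepsilon>0$ such that $\lambda_{i,k}\in[\varepsilon,1]$ and $\alpha_k\in[\varepsilon,2-\varepsilon]$ for all $k$ and all $i\in I_k$. (v) $\{I_k\}_{k=0}^\infty$ is $s$-intermittent for some integer $s\ge1$, that is, $I=I_k\cup\dots\cup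 I_{k+s}$ for all $k$. (vi) Each $T_i$, $i\in I$, is weakly regular. If the sequence $\{x_k\}_{k=0}^\infty$ is bounded, then it converges weakly to some $x_\infty\in C\cap Q$. Furthermore, if (vi') each $T_i$, $i\in I$, is boundedly regular and the family $\{Q\}\cup\{C_i: i\in I\}$ is boundedly regular, then the convergence is in norm.
   Context: $\operatorname{Fix}T:=\{x\in\mathcal H: T(x)=x\}$. An operator $T\colon\mathcal H\to\mathcal H$ with $\operatorname{Fix}T\ne\emptyset$ is a cutter if $\langle z-T(x),x-T(x)\rangle\le0$ for all $x\in\mathcal H$ and all $z\in\operatorname{Fix}T$ (then $\operatorname{Fix}T$ is closed and convex). $P_Q$ is the metric projection onto $Q$, and $d(x,A):=\inf_{z\in A}\|x-z\|$. An operator $T$ with a fixed point is weakly regular if for every sequence $\{y_k\}\subset\mathcal H$ and every $y_\infty\in\mathcal H$: if $y_k\rightharpoonup y_\infty$ (weakly) and $T(y_k)-y_k\to0$ (in norm), then $y_\infty\in\operatorname{Fix}T$. It is boundedly regular if for every bounded sequence $\{y_k\}\subset\mathcal H$, $\|T(y_k)-y_k\|\to0$ implies $d(y_k,\operatorname{Fix}T)\to0$. A family $\{D_j: j\in J\}$ of closed convex sets with nonempty intersection $D$ is boundedly regular if for every bounded sequence $\{y_k\}\subset\mathcal H$, $\lim_{k\to\infty}\sup_{j\in J}d(y_k,D_j)=0$ implies $\lim_{k\to\infty}d(y_k,D)=0$. *)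

(* Defs.v *)
From HB Require Import structures.
From mathcomp Require Import all_boot all_order all_algebra.
From mathcomp Require Import all_classical all_reals all_analysis.

Set Implicit Arguments.
Unset Strict Implicit.
Unset Printing Implicit Defensive.

Import Order.TTheory GRing.Theory Num.Theory.
Import numFieldNormedType.Exports.

Local Open Scope classical_set_scope.
Local Open Scope ring_scope.

(* A real Hilbert space is a complete normed module H over R : realType together
   with a dot product, i.e. a positive definite symmetric bilinear form
   [dot : {dot H for idfun}], that induces the norm of H. *)
Definition induces_norm (R : realType) (H : completeNormedModType R)
    (dot : {dot H for idfun}) : Prop :=
  forall x : H, dot x x = `|x| ^+ 2.

Definition weak_cvg (R : realType) (H : completeNormedModType R)
    (dot : {dot H for idfun}) (y : nat -> H) (l : H) : Prop :=
  forall h : H, (fun k => dot (y k) h) @ \oo --> dot l h.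

(* [inf] is real-valued and equals 0 on the empty set, so [dist x A] is
   meaningful for nonempty A only. *)
Definition dist (R : realType) (H : completeNormedModType R)
    (x : H) (A : set H) : R :=
  inf [set `|x - z| | z in A].

(* The nearest point of Q to y; the default value y is taken only if there is
   no nearest point, which does not happen for Q nonempty, closed and convex in
   a Hilbert space (the nearest point is then also unique). *)
Definition metric_proj (R : realType) (H : completeNormedModType R)
    (Q : set H) (y : H) : H :=
  xget y [set p | Q p /\ forall q, Q q -> `|y - p| <= `|y - q|].

Definition fixpts (H : Type) (T : H -> H) : set H := [set x | T x = x].

Definition cutter (R : realType) (H : completeNormedModType R)
    (dot : {dot H for idfun}) (T : H -> H) : Prop :=
  fixpts T !=set0 /\
  forall x z, fixpts T z -> dot (z - T x) (x - T x) <= 0.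

Definition weakly_regular (R : realType) (H : completeNormedModType R)
    (dot : {dot H for idfun}) (T : H -> H) : Prop :=
  forall (y : nat -> H) (l : H), weak_cvg dot y l ->
    (fun k => T (y k) - y k) @ \oo --> (0 : H) -> fixpts T l.

Definition boundedly_regular (R : realType) (H : completeNormedModType R)
    (T : H -> H) : Prop :=
  forall y : nat -> H, bounded_fun y ->
    (fun k => `|T (y k) - y k|) @ \oo --> (0 : R) ->
    (fun k => dist (y k) (fixpts T)) @ \oo --> (0 : R).

(* To be used for closed convex sets with a nonempty intersection; the
   distances d(y_k, D_j) are then bounded in j by d(y_k, D), so that the real
   supremum [sup] is the genuine one. *)
Definition boundedly_regular_family (R : realType)
    (H : completeNormedModType R) (J : Type) (D : J -> set H) : Prop :=
  forall y : nat -> H, bounded_fun y ->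
    (fun k => sup (range (fun j => dist (y k) (D j)))) @ \oo --> (0 : R) ->
    (fun k => dist (y k) (\bigcap_j D j)) @ \oo --> (0 : R).

(* The family {Q} together with the C_i, indexed by [option I]. *)
Definition adjoin (H I : Type) (Q : set H) (C : I -> set H) (j : option I) :
    set H :=
  if j is Some i then C i else Q.

Definition overrelax (R : realType) (H : completeNormedModType R)
    (r : R) (phi : H -> R) (T : H -> H) (x : H) : R :=
  if T x == x then 0 else (r / phi x + `|T x - x|) / `|T x - x|.

Definition intermittent (m : nat) (s : nat) (Ik : nat -> {set 'I_m}) : Prop :=
  forall k, (\bigcup_(l < s.+1) Ik (k + l)%N)%SET = [set: 'I_m]%SET.

(* Main.v *)
Require Import Defs.
From HB Require Import structures.
From mathcomp Require Import all_boot all_order all_algebra.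
From mathcomp Require Import all_classical all_reals all_analysis.
From mathcomp Require Import ring lra.

Set Implicit Arguments.
Unset Strict Implicit.
Unset Printing Implicit Defensive.

(** The argument is a perturbed Fejer-monotonicity argument. Write
    d_ik = |T_i x_k - x_k| and rho_ik = r_k / phi_i(x_k). The overrelaxation
    factor is chosen so that the step along a nonzero T_i x_k - x_k has length
    alpha_k (d_ik + rho_ik): it is the classical relaxed step, overshot by an
    amount controlled by r_k. For a common fixed point z in Q the cutter
    inequality <T_i x - x, z - x> >= d^2 and alpha_k in [eps, 2 - eps] give, for
    a single operator, a decrease of |x - z|^2 by eps^2 d^2 up to an error
    4 rho (d + rho) ([overrelaxed_cutter_step]). Convexity of the squared norm
    averages this over I_k and the projection onto Q does not increase the
    distance to z ([simultaneous_step]); since x_k is bounded, phi_i is bounded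
    below along it and d_ik is bounded, so that
      |x_(k+1) - z|^2 + eps^3 sum_(i in I_k) d_ik^2 <= |x_k - z|^2 + c r_k
    with c independent of k and of z.

    As the series of r converges, |x_k - z| converges for every z in the
    solution set and the sums of d_ik over I_k tend to 0 ([quasi_fejer_cvg]);
    these sums also control |x_(k+1) - x_k|. By intermittency each index i is
    used within s steps of any k, at some time n_i(k), so x_(n_i(k)) - x_k -> 0
    while T_i x_(n_i(k)) - x_(n_i(k)) -> 0. Weak regularity, together with weak
    closedness of Q, puts every weak subsequential limit of x in the solution
    set. Bounded sequences have weakly convergent subsequences
    ([bounded_weak_subseq]), and Opial's argument ([opial]) yields weak
    convergence of the whole sequence.

    Under bounded regularity the same times n_i(k) give d(x_k, C_i) -> 0 for
    each i, hence d(x_k, C inter Q) -> 0. Because c does not depend on z, once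
    x_k is close to some z in the solution set all later iterates stay close to
    z, and so does the weak limit: convergence is in norm ([fejer_dist_cvg]).

    The Hilbert space facts used all come from one minimization,
    [variational_inequality], which yields both the metric projection and the
    Riesz representation theorem. *)

Import Order.TTheory GRing.Theory Num.Theory.
Import numFieldNormedType.Exports.

Local Open Scope classical_set_scope.
Local Open Scope ring_scope.

(** * Real and vector sequences *)

Lemma le_cvgn_seq (f : nat -> nat) : (forall k, (k <= f k)%N) -> f @ \oo --> \oo.
Proof.
move=> fk A [N _ NA]; exists N => // k /= Nk; apply: NA => /=.
exact: leq_trans (fk k).
Qed.

Lemma increasing_seq_ge (f : nat -> nat) :
  increasing_seq f -> forall k, (k <= f k)%N.
Proof.
move=> /increasing_seqP fS; elim=> // k ih; apply: leq_ltn_trans ih _.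
by have := fS k; rewrite ltEnat.
Qed.

Lemma increasing_seq_cvg (f : nat -> nat) : increasing_seq f -> f @ \oo --> \oo.
Proof. by move=> /increasing_seq_ge/le_cvgn_seq. Qed.

(** The diagonal choice behind the extraction of weakly convergent
    subsequences. *)
Lemma increasing_choice (P : nat -> set nat) :
  (forall n N, exists2 k, (N <= k)%N & P n k) ->
  exists2 f : nat -> nat, increasing_seq f & forall n, P n (f n).
Proof.
move=> Pn.
have next p : {k | (p.2 <= k)%N & P p.1 k}.
  by apply: cid2; exact: Pn.
pose f := fix f n :=
  if n is n'.+1 then s2val (next (n, (f n').+1)) else s2val (next (0, 0)%N).
exists f; last by case=> [|n] /=; exact: s2valP'.
apply/increasing_seqP => n; rewrite ltEnat /=.
exact: (s2valP (next (n.+1, (f n).+1))).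
Qed.

Lemma cvg0_norm_le (R : realFieldType) (V : pseudoMetricNormedZmodType R)
    (b : nat -> R) (u : nat -> V) :
  (forall k, `|u k| <= b k) -> b @ \oo --> 0 -> u @ \oo --> 0.
Proof.
move=> ub b0; apply: norm_cvg0.
apply: (@squeeze_cvgr _ _ _ _ (fun=> 0) b) => //; last exact: cvg_cst.
by apply: nearW => k; rewrite normr_ge0 ub.
Qed.

Lemma bounded_funE (R : realFieldType) (V : pseudoMetricNormedZmodType R)
    (y : nat -> V) : bounded_fun y <-> exists M, forall k, `|y k| <= M.
Proof.
have PF : ProperFilter (globally [set: nat]).
  exact: (@globally_properfilter _ setT 0%N).
split=> [/ex_bound[M yM]|[M yM]]; first by exists M => k; exact: yM.
by apply/ex_bound; exists M => k _; exact: yM.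
Qed.

(** * Inner product, metric projection and Riesz representation *)

Section Hilbert.
Variables (R : realType) (H : completeNormedModType R).
Variable dot : {dot H for idfun}.
Hypothesis Hdot : induces_norm dot.
Implicit Types (u v w h : H) (K Q : set H) (y : nat -> H).

Lemma dotC u v : dot u v = dot v u.
Proof. by have := @hermitian_subproof _ _ _ _ dot u v; rewrite expr0 mul1r. Qed.

Lemma dotDl u v w : dot (u + v) w = dot u w + dot v w.
Proof. exact: linearDl. Qed.
Lemma dotBl u v w : dot (u - v) w = dot u w - dot v w.
Proof. exact: linearBl. Qed.
Lemma dotNl u w : dot (- u) w = - dot u w.
Proof. exact: linearNl. Qed.
Lemma dotZl a u w : dot (a *: u) w = a * dot u w.
Proof. exact: linearZl_LR. Qed.
Lemma dotDr u v w : dot w (u + v) = dot w u + dot w v.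
Proof. by rewrite dotC dotDl ![dot _ w]dotC. Qed.
Lemma dotBr u v w : dot w (u - v) = dot w u - dot w v.
Proof. by rewrite dotC dotBl ![dot _ w]dotC. Qed.
Lemma dotNr u w : dot w (- u) = - dot w u.
Proof. by rewrite dotC dotNl (dotC _ w). Qed.
Lemma dotZr a u w : dot w (a *: u) = a * dot w u.
Proof. by rewrite dotC dotZl (dotC _ w). Qed.

Definition dotE := (dotDl, dotNl, dotZl, dotDr, dotNr, dotZr).

Lemma sqr_normD u v : `|u + v| ^+ 2 = `|u| ^+ 2 + 2 * dot u v + `|v| ^+ 2.
Proof. by rewrite -!Hdot !dotE [dot v u]dotC; ring. Qed.

Lemma sqr_normB u v : `|u - v| ^+ 2 = `|u| ^+ 2 - 2 * dot u v + `|v| ^+ 2.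
Proof. by rewrite -!Hdot !dotE [dot v u]dotC; ring. Qed.

Lemma cauchy_schwarz u v : `|dot u v| <= `|u| * `|v|.
Proof.
have [->|v0] := eqVneq v 0.
  by rewrite -[X in dot _ X](subrr 0) dotBr subrr !normr0 mulr0.
have nv : 0 < `|v| by rewrite normr_gt0.
rewrite -ler_sqr ?nnegrE ?mulr_ge0// exprMn real_normK ?num_real//.
(* This vector is |v|^2 times the component of u orthogonal to v. *)
have : 0 <= `| `|v| ^+ 2 *: u - dot u v *: v| ^+ 2 by rewrite exprn_ge0.
rewrite -[leRHS]Hdot !dotE [dot v u]dotC !Hdot.
set a := `|v|^+2; set b := dot u v; set c := `|u|^+2.
have a0 : 0 < a by rewrite exprn_gt0.
rewrite [leRHS](_ : _ = a * (c * a - b ^+ 2)); last by ring.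
by rewrite pmulr_rge0// subr_ge0.
Qed.

Lemma dot_le u v : dot u v <= `|u| * `|v|.
Proof. exact: le_trans (ler_norm _) (cauchy_schwarz u v). Qed.

Lemma convex_setD K : convex_set K -> forall u v t, 0 <= t <= 1 ->
  K u -> K v -> K (u + t *: (v - u)).
Proof.
move=> cK u v t /andP[t0 t1] /mem_set Ku /mem_set Kv.
have := cK v u (Itv01 t0 t1) Kv Ku; rewrite inE.
rewrite /conv /= /unstable.onem; congr K.
by rewrite scalerBl scale1r scalerBr addrCA.
Qed.

(** The Lions--Stampacchia theorem for the inner product itself. The functional
    J u = |u|^2 - 2 l u is bounded below by - M^2, and since l is linear the
    parallelogram identity makes every minimizing sequence on K Cauchy. The
    inequality is the first-order condition for the minimizer p. With
    l = dot u it characterizes the projection of u onto K; with K the whole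
    space it represents l. *)
Lemma variational_inequality K (l : H -> R) (M : R) :
  closed K -> convex_set K -> K !=set0 ->
  (forall u v, l (u + v) = l u + l v) ->
  (forall a u, l (a *: u) = a * l u) ->
  (forall u, `|l u| <= M * `|u|) ->
  exists2 p, K p & forall q, K q -> l (q - p) <= dot p (q - p).
Proof.
move=> clK cvK [q0 Kq0] lD lZ lM.
have lB u v : l (u - v) = l u - l v by rewrite lD -scaleN1r lZ mulN1r.
pose J u := `|u| ^+ 2 - 2 * l u.
have JM u : - M ^+ 2 <= J u.
  rewrite /J; have := lM u; rewrite ler_norml => /andP[_ lu].
  have : 0 <= (`|u| - M) ^+ 2 by rewrite sqr_ge0.
  nra.
have infJ : has_inf (J @` K).
  by split; [exists (J q0), q0|exists (- M ^+ 2) => _ [u _ <-]].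
set c := inf (J @` K).
have cJ u : K u -> c <= J u by move=> Ku; apply: (ge_inf infJ.2); exists u.
have hq n : {q | K q & J q < c + n.+1%:R^-1}.
  apply: cid2; have n0 : 0 < n.+1%:R^-1 :> R by rewrite invr_gt0.
  by have [_ [q Kq <-] Jq] := inf_adherent n0 infJ; exists q.
pose q n := s2val (hq n).
have Kq n : K (q n) by exact: s2valP (hq n).
have Jq n : J (q n) < c + n.+1%:R^-1 by exact: s2valP' (hq n).
(* Compare J at the midpoint of q n and q m, which lies in K, with inf J. *)
have qq n m : `|q n - q m| ^+ 2 <= 2 * (n.+1%:R^-1 + m.+1%:R^-1).
  have h2 : 0 <= (2^-1 : R) <= 1 by lra.
  have := cJ _ (convex_setD cvK h2 (Kq n) (Kq m)).
  have := Jq n; have := Jq m; rewrite /J lD lZ lB sqr_normB -!Hdot !dotE.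
  rewrite [dot (q m) (q n)]dotC.
  set a := n.+1%:R^-1; set b := m.+1%:R^-1; lra.
have : cvgn q.
  apply/cauchy_cvgP/cauchy_exP => e e0.
  have e4 : 0 < e ^+ 2 / 4 by rewrite divr_gt0// exprn_gt0.
  have [N _ hN] := near_infty_natSinv_lt (PosNum e4).
  exists (q N); exists N => // n /= Nn; rewrite -ball_normE /=.
  rewrite -ltr_sqr ?nnegrE// ?ltW// (le_lt_trans (qq N n))//.
  have {}hN k : (N <= k)%N -> k.+1%:R^-1 < e ^+ 2 / 4 by move=> /hN.
  have := hN _ (leqnn N); have := hN _ Nn.
  set a := n.+1%:R^-1; set b := N.+1%:R^-1; lra.
move=> /cvg_ex[p qp].
have Kp : K p by apply: (closed_cvg K clK) qp; exact: nearW.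
have Jp : J p <= c.
  have cJq : J (q n) @[n --> \oo] --> J p.
    apply: cvgB.
      rewrite expr2; under eq_fun do rewrite expr2.
      by apply: cvgM; apply: cvg_norm.
    apply: cvgMl_tmp; apply/subr_cvg0.
    apply: (@cvg0_norm_le _ _ (fun n => M * `|q n - p|)) => [k|].
      by rewrite /= -lB.
    rewrite -(mulr0 M); apply: cvgMl_tmp; rewrite -(@normr0 _ H); apply: cvg_norm.
    by apply/subr_cvg0.
  have cn : (c + n.+1%:R^-1) @[n --> \oo] --> c + 0.
    by apply: cvgD; [exact: cvg_cst|exact: cvg_harmonic].
  rewrite -[leRHS]addr0; apply: ler_cvg_to cJq cn _.
  by apply: nearW => n; exact: ltW.
exists p => // v Kv; rewrite -subr_ge0.
have key t : 0 < t -> t <= 1 ->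
    0 <= 2 * (dot p (v - p) - l (v - p)) + t * `|v - p| ^+ 2.
  move=> t0 t1; have t01 : 0 <= t <= 1 by rewrite ltW.
  have := le_trans Jp (cJ _ (convex_setD cvK t01 Kp Kv)).
  rewrite /J lD lZ sqr_normD dotZr -subr_ge0 normrZ (gtr0_norm t0).
  set X := (X in 0 <= X -> _); move=> X0; rewrite -(pmulr_rge0 _ t0).
  by rewrite (_ : _ * _ = X)// /X; ring.
(* Letting t tend to 0 in key would give 0 <= A; if A < 0, the choice
   t = - A / (B - A), which lies in ]0, 1[, already contradicts key. *)
set A := _ - _ in key *; set B := `|_| ^+ 2 in key.
have B0 : 0 <= B by rewrite exprn_ge0.
rewrite leNgt; apply/negP => A0.
have BA : 0 < B - A by lra.
have := key (- A / (B - A)).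
rewrite ler_pdivrMr// divr_gt0 ?oppr_gt0// => /(_ isT).
rewrite (_ : (_ <= _)); last lra.
move=> /(_ isT); rewrite -(pmulr_lge0 _ BA) mulrDl (mulrAC (- A / _)) divfK ?gt_eqF//.
nra.
Unshelve. all: by end_near.
Qed.

(** The obtuse-angle characterization of the projection. The point p given by
    the variational inequality satisfies |u - p|^2 + |p - q|^2 <= |u - q|^2 on
    Q, so p is the only nearest point and [metric_proj] selects it. *)
Lemma metric_projP Q u : closed Q -> convex_set Q -> Q !=set0 ->
  Q (metric_proj Q u) /\
  forall q, Q q -> dot (u - metric_proj Q u) (q - metric_proj Q u) <= 0.
Proof.
move=> clQ cvQ Q0.
have [|||p Qp hp] := @variational_inequality Q (dot u) `|u| clQ cvQ Q0.
- by move=> *; rewrite dotDr.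
- by move=> *; rewrite dotZr.
- by move=> v; exact: cauchy_schwarz.
have hd q : Q q -> `|u - p| ^+ 2 + `|p - q| ^+ 2 <= `|u - q| ^+ 2.
  move=> /hp; rewrite -!Hdot !dotE [dot p u]dotC [dot q u]dotC [dot q p]dotC; lra.
suff -> : metric_proj Q u = p by split => // q /hp; rewrite dotBl subr_le0.
rewrite /metric_proj; apply: xget_unique => [|v [Qv hv]].
  split => // q Qq; rewrite -ler_sqr ?nnegrE// (le_trans _ (hd _ Qq))//.
  by rewrite lerDl exprn_ge0.
apply/eqP; rewrite eq_sym -subr_eq0 -normr_eq0 -sqrf_eq0 eq_le exprn_ge0// andbT.
have := hd _ Qv; have := hv _ Qp; rewrite -ler_sqr ?nnegrE//; lra.
Qed.

Lemma metric_proj_le Q u q : closed Q -> convex_set Q -> Q q ->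
  `|metric_proj Q u - q| <= `|u - q|.
Proof.
move=> clQ cvQ Qq; have [_ /(_ _ Qq)] := metric_projP u clQ cvQ (ex_intro _ q Qq).
set p := metric_proj Q u => hp; rewrite -ler_sqr ?nnegrE//.
have : 0 <= `|u - p| ^+ 2 by rewrite exprn_ge0.
move: hp; rewrite -!Hdot !dotE [dot p u]dotC [dot q u]dotC [dot q p]dotC; lra.
Qed.

Lemma riesz_representation (l : H -> R) (M : R) :
  (forall u v, l (u + v) = l u + l v) ->
  (forall a u, l (a *: u) = a * l u) ->
  (forall u, `|l u| <= M * `|u|) -> exists p, forall h, l h = dot p h.
Proof.
move=> lD lZ lM.
have [|p _ hp] := variational_inequality (@closedT H) _ (ex_intro _ 0 I) lD lZ lM.
  by move=> *; rewrite inE.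
exists p => h; apply/eqP; rewrite eq_le; apply/andP; split.
  by have := hp (h + p) I; rewrite addrK.
have := hp (p - h) I; rewrite addrAC subrr add0r -scaleN1r lZ dotZr; lra.
Qed.

End Hilbert.

(** * Weak convergence *)

Section Weak.
Variables (R : realType) (H : completeNormedModType R).
Variable dot : {dot H for idfun}.
Hypothesis Hdot : induces_norm dot.
Implicit Types (u v w h : H) (K Q : set H) (y : nat -> H).

Lemma cvg_dot y l : weak_cvg dot y l ->
  forall h, dot h (y k) @[k --> \oo] --> dot h l.
Proof. by move=> yl h; under eq_fun do rewrite dotC; rewrite dotC; exact: yl. Qed.

Lemma weak_cvg_perturb y z l : weak_cvg dot y l -> (z k - y k) @[k --> \oo] --> 0 ->
  weak_cvg dot z l.
Proof.
move=> yl zy h; rewrite -[dot l h]addr0.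
rewrite (_ : (fun k => _) = (fun k => dot (y k) h + dot (z k - y k) h)); last first.
  by apply/funext => k; rewrite -dotDl subrKC.
apply: cvgD; first exact: yl.
apply: (@cvg0_norm_le _ _ (fun k => `|z k - y k| * `|h|)).
  by move=> k; exact: cauchy_schwarz.
by rewrite -(mul0r `|h|); apply: cvgMr_tmp; rewrite -(@normr0 _ H); exact: cvg_norm.
Qed.

(** Closed convex sets are weakly closed: the obtuse-angle inequality at the
    projection p of the weak limit l passes to the limit and reads
    |l - p|^2 <= 0. *)
Lemma weak_cvg_closed Q y l : closed Q -> convex_set Q -> (forall k, Q (y k)) ->
  weak_cvg dot y l -> Q l.
Proof.
move=> clQ cvQ Qy yl.
have [Qp hp] := metric_projP Hdot l clQ cvQ (ex_intro _ _ (Qy 0%N)).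
set p := metric_proj Q l in Qp hp; suff -> : l = p by [].
have : dot (l - p) (l - p) <= 0.
  apply: (@ler_cvg_to _ \oo _ _ (fun k => dot (l - p) (y k - p)) (fun=> 0)).
  - under eq_fun do rewrite dotBr.
    by rewrite dotBr; apply: cvgB; [exact: cvg_dot|exact: cvg_cst].
  - exact: cvg_cst.
  - by apply: nearW => k; apply: hp.
rewrite Hdot => h; apply/eqP; rewrite -subr_eq0 -normr_eq0 -sqrf_eq0 eq_le h.
by rewrite exprn_ge0.
Qed.

(** Weak lower semicontinuity of the norm, tested against the limit. *)
Lemma weak_cvg_norm_le y l b : weak_cvg dot y l ->
  (\forall k \near \oo, `|y k| <= b) -> `|l| <= b.
Proof.
move=> yl yb; have b0 : 0 <= b.
  by have [k] := filter_ex yb => /(le_trans (normr_ge0 _)).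
have [->|l0] := eqVneq l 0; first by rewrite normr0.
have nl : 0 < `|l| by rewrite normr_gt0.
rewrite -(ler_pM2r nl) -expr2 -Hdot.
apply: (@ler_cvg_to _ \oo _ _ (fun k => dot (y k) l) (fun=> b * `|l|)) => //.
  exact: cvg_cst.
near=> k; apply: le_trans (dot_le Hdot _ _) _.
by rewrite ler_wpM2r//; near: k.
Unshelve. all: by end_near.
Qed.

Lemma weak_cvgB y l z : weak_cvg dot y l -> weak_cvg dot (fun k => y k - z) (l - z).
Proof.
move=> yl h; under eq_fun do rewrite dotBl.
by rewrite dotBl; apply: cvgB; [exact: yl|exact: cvg_cst].
Qed.

(** Along an ultrafilter every bounded real sequence converges, so
    h |-> lim <y_k, h> is a linear functional bounded by M, which Riesz
    represents by the weak limit. *)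
Lemma ultra_weak_limit (U : set_system nat) y M : UltraFilter U ->
  (forall k, `|y k| <= M) ->
  exists l, forall h, dot (y k) h @[k --> U] --> dot l h.
Proof.
move=> UU yM.
have lim h : exists a : R, dot (y k) h @[k --> U] --> a.
  have yh k : `|dot (y k) h| <= M * `|h|.
    exact: le_trans (cauchy_schwarz Hdot _ _) (ler_wpM2r _ _).
  have yI : U ((fun k => dot (y k) h) @^-1` `[- (M * `|h|), M * `|h|]).
    by apply: (@filterE _ U) => k /=; rewrite in_itv /= -ler_norml.
  have [a [_ cla]] := @segment_compact R _ _ (dot (y k) h @[k --> U]) _ yI.
  exists a => B aB.
  have [//|UB] := in_ultra_setVsetC ((fun k => dot (y k) h) @^-1` B) UU.
  have [b [nBb Bb]] := cla (~` B) B UB aB.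
  by have := nBb Bb.
have {lim} [l yl] := choice lim.
have yl_eq h a : dot (y k) h @[k --> U] --> a -> l h = a.
  by move=> ya; apply: cvg_unique (yl h) ya.
have [||u|p lp] := @riesz_representation _ _ _ Hdot l M.
- move=> u v; apply: yl_eq; under eq_fun do rewrite dotDr.
  by apply: cvgD; exact: yl.
- move=> a u; apply: yl_eq; under eq_fun do rewrite dotZr.
  by apply: cvgMl_tmp; exact: yl.
- rewrite ler_norml; apply/andP; split.
    apply: (@ler_cvg_to _ U _ _ (fun=> - (M * `|u|)) (fun k => dot (y k) u))
      (cvg_cst _) (yl u) _.
    apply: nearW => k; have := cauchy_schwarz Hdot (y k) u.
    rewrite ler_norml => /andP[+ _]; apply: le_trans; rewrite lerN2.
    exact: ler_wpM2r.
  apply: (@ler_cvg_to _ U _ _ (fun k => dot (y k) u) (fun=> M * `|u|))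
    (yl u) (cvg_cst _) _.
  by apply: nearW => k; apply: le_trans (dot_le Hdot _ _) (ler_wpM2r _ _).
by exists p => h; rewrite -lp; exact: yl.
Qed.

(** It suffices to test weak convergence of a subsequence of a bounded sequence
    against the terms of the sequence: the test vectors h for which it holds
    form a closed subspace W containing every y_j, and a vector orthogonal to
    all y_j belongs to W trivially; h is the sum of its projection onto W and a
    vector orthogonal to W. *)
Lemma weak_cvg_test_on_terms y l M : (forall k, `|y k| <= M) ->
  (forall u, (forall k, dot (y k) u = 0) -> dot l u = 0) ->
  forall f : nat -> nat,
  (forall j, dot (y (f k)) (y j) @[k --> \oo] --> dot l (y j)) ->
  weak_cvg dot (y \o f) l.
Proof.
move=> yM yperp f yfj.
pose W := [set h | dot (y (f k)) h @[k --> \oo] --> dot l h].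
have WZD a u v : W u -> W v -> W (a *: u + v).
  rewrite /W /= => Wu Wv; under eq_fun do rewrite dotDr dotZr.
  by rewrite dotDr dotZr; apply: cvgD => //; apply: cvgMl_tmp.
have W0 : W 0.
  have d0 u : dot u 0 = 0 by rewrite -(scale0r 0) dotZr mul0r.
  by rewrite /W /= d0; under eq_fun do rewrite d0; exact: cvg_cst.
have cvW : convex_set W.
  move=> u v t; rewrite !inE => Wu Wv; rewrite /conv /=; apply: (WZD) => //.
  by rewrite -[_ *: v]addr0; exact: WZD.
have clW : closed W.
  move=> h clh; rewrite /W /=; apply/cvgrPdist_lt => e e0.
  have M0 : 0 <= M by exact: le_trans (yM 0%N).
  pose D := M + `|l| + 1; have D0 : 0 < D by rewrite ltr_pwDr// addr_ge0.
  have e2 : 0 < e / (2 * D) by rewrite divr_gt0// mulr_gt0.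
  have [u [Wu]] := clh _ (nbhsx_ballx h _ e2).
  rewrite -ball_normE /= => hu.
  have e3 : 0 < e / 2 by rewrite divr_gt0.
  move/cvgrPdist_lt: Wu => /(_ _ e3); apply: filterS => k huk.
  rewrite (_ : _ - _ = (dot l u - dot (y (f k)) u) + dot (l - y (f k)) (h - u)).
    rewrite (le_lt_trans (ler_normD _ _))// [e]splitr ltr_leD//.
    rewrite (le_trans (cauchy_schwarz Hdot _ _))//.
    have : `|l - y (f k)| <= D.
      by rewrite (le_trans (ler_normB _ _))// /D; have := yM (f k); lra.
    have : `|h - u| * (2 * D) <= e by rewrite -ler_pdivlMr ?mulr_gt0// ltW.
    by have := normr_ge0 (h - u); nra.
  by rewrite dotBl !dotBr; ring.
move=> h; have [Wp hp] := metric_projP Hdot h clW cvW (ex_intro _ _ W0).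
set p := metric_proj W h in Wp hp.
have perp k : dot (y k) (h - p) = 0.
  have Wk a : W (a *: y k + p) by apply: WZD => //; exact: yfj.
  have := hp _ (Wk 1); have := hp _ (Wk (-1)).
  by rewrite !addrK !dotZr dotC; lra.
have : W (1 *: (h - p) + p); last by rewrite scale1r subrK.
apply: WZD => //; rewrite /W /= yperp//.
by under eq_fun do rewrite perp; exact: cvg_cst.
Qed.

(** Weak sequential compactness without separability: the ultrafilter limit l
    is approached, against finitely many of the y_j at a time, on a set of the
    ultrafilter, hence frequently; a diagonal choice gives a subsequence
    converging to l against all y_j. *)
Theorem bounded_weak_subseq y M : (forall k, `|y k| <= M) ->
  exists2 f : nat -> nat, increasing_seq f & exists l, weak_cvg dot (y \o f) l.
Proof.
move=> yM; have [U [UU Uoo]] :=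
  ultraFilterLemma (@eventually_filter : ProperFilter \oo).
have [l yl] := ultra_weak_limit UU yM.
pose P n := [set k | forall j, (j <= n)%N ->
  `|dot l (y j) - dot (y k) (y j)| < n.+1%:R^-1].
have PU n : U (P n).
  have e0 : 0 < n.+1%:R^-1 :> R by rewrite invr_gt0.
  have : U [set k | forall j : 'I_n.+1,
      `|dot l (y j) - dot (y k) (y j)| < n.+1%:R^-1].
    apply: filter_forall => j; move/cvgrPdist_lt: (yl (y j)); exact.
  by apply: filterS => k hk j jn; exact: (hk (Ordinal (jn : (j < n.+1)%N))).
have [n N|f fi fP] := @increasing_choice P.
  have /filter_ex [k [/= Nk Pk]] : U ([set k | (N <= k)%N] `&` P n).
    by apply: filterI => //; apply: Uoo; exists N.
  by exists k.
exists f => //; exists l; apply: (weak_cvg_test_on_terms yM) => [u yu|j].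
  have y0 : dot (y k) u @[k --> U] --> 0.
    by under eq_fun do rewrite yu; exact: cvg_cst.
  by apply: cvg_unique (yl u) y0.
apply/cvgrPdist_lt => e e0.
near=> k; have jk : (j <= k)%N by near: k; exists j.
apply: lt_trans (fP k j jk) _; near: k.
exact: (near_infty_natSinv_lt (PosNum e0)).
Unshelve. all: by end_near.
Qed.

(** Opial's lemma. If l and l' are two weak subsequential limits, both in A,
    then <y_k, l - l'> is an affine combination of |y_k - l'|^2 and
    |y_k - l|^2, hence converges; evaluating its limit along both subsequences
    gives |l - l'|^2 = 0. *)
Theorem opial (A : set H) y M : (forall k, `|y k| <= M) ->
  (forall z, A z -> cvgn (fun k => `|y k - z| ^+ 2)) ->
  (forall f l, increasing_seq f -> weak_cvg dot (y \o f) l -> A l) ->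
  exists2 l, A l & weak_cvg dot y l.
Proof.
move=> yM yA Acl.
have [f fi [l yfl]] := bounded_weak_subseq yM.
have Al := Acl _ _ fi yfl; exists l => // h.
have uniq g l' : increasing_seq g -> weak_cvg dot (y \o g) l' -> l' = l.
  move=> gi ygl'; have Al' := Acl _ _ gi ygl'.
  have [c yc] : exists c : R, dot (y k) (l - l') @[k --> \oo] --> c.
    have /cvg_ex[a ya] := yA _ Al; have /cvg_ex[b yb] := yA _ Al'.
    exists (2^-1 * (b - a + `|l| ^+ 2 - `|l'| ^+ 2)).
    rewrite (_ : (fun k => _) = (fun k => 2^-1 *
      (`|y k - l'| ^+ 2 - `|y k - l| ^+ 2 + `|l| ^+ 2 - `|l'| ^+ 2))).
      apply: cvgMl_tmp; apply: cvgB; last exact: cvg_cst.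
      by apply: cvgD; [exact: cvgB|exact: cvg_cst].
    by apply/funext => k; rewrite !(sqr_normB Hdot) dotBr; field.
  have e1 : dot l (l - l') = c.
    apply: cvg_unique (yfl _) _ => //.
    exact: (cvg_comp f (fun k => dot (y k) (l - l')) (increasing_seq_cvg fi)).
  have e2 : dot l' (l - l') = c.
    apply: cvg_unique (ygl' _) _ => //.
    exact: (cvg_comp g (fun k => dot (y k) (l - l')) (increasing_seq_cvg gi)).
  apply/esym/eqP; rewrite -subr_eq0 -normr_eq0 -sqrf_eq0 -Hdot dotBl e1 e2.
  by rewrite subrr.
(* Otherwise some subsequence stays away from l against h, and it has a weakly
   convergent subsequence, whose limit must be l. *)
apply: contrapT => /cvgrPdist_lt; rewrite -existsNE => -[e].
move=> /not_implyP[e0 ne].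
have [n N|g gi gP] := @increasing_choice
    (fun=> [set k | e <= `|dot l h - dot (y k) h|]).
  apply: contrapT => nk; apply: ne; exists N => // k /= Nk.
  by rewrite ltNge; apply/negP => ek; apply: nk; exists k.
have [f' f'i [l' yl']] := bounded_weak_subseq (fun k => yM (g k)).
have gf : increasing_seq (g \o f') by move=> n m /=; rewrite gi; exact: f'i.
have ll' := uniq _ _ gf yl'; rewrite ll' in yl'.
have /cvgrPdist_lt/(_ _ e0)/filter_ex[k /=] := yl' h.
by rewrite ltNge gP.
Qed.

End Weak.

(** * Quasi-Fejer monotone sequences *)

(** Subtracting c times the partial sums of r turns a into a nonincreasing
    sequence b that is bounded below, and D is dominated by the decrements
    of b. *)
Lemma quasi_fejer_cvg (R : realType) (a D r : nat -> R) (c : R) :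
  (forall k, 0 <= a k) -> (forall k, 0 <= D k) ->
  (forall k, a k.+1 + D k <= a k + c * r k) -> cvgn (series r) ->
  cvgn a /\ D @ \oo --> 0.
Proof.
move=> a0 D0 step Sc.
pose b k := a k - c * series r k.
have bS k : D k <= b k - b k.+1.
  by rewrite /b /series /= big_nat_recr//= mulrDr; have := step k; lra.
have [B SB] := (bounded_funE (series r)).1 (cvg_seq_bounded Sc).
have b_cvg : cvgn b.
  apply: nonincreasing_is_cvgn.
    by apply/nonincreasing_seqP => k; have := bS k; have := D0 k; lra.
  exists (- (`|c| * B)) => _ [k _ <-]; rewrite /b.
  have : c * series r k <= `|c| * B.
    by rewrite (le_trans (ler_norm _))// normrM ler_wpM2l.
  by have := a0 k; lra.
split.
  rewrite (_ : a = b \+ (fun k => c * series r k)).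
    by apply: is_cvgD => //; apply: is_cvgMl_tmp.
  by apply/funext => k; rewrite /b /= subrK.
have /cvg_ex[l bl] := b_cvg.
apply: (@cvg0_norm_le _ _ (fun k => b k - b k.+1)) => [k|].
  by rewrite ger0_norm.
rewrite -(subrr l); apply: cvgB => //.
by apply/(cvg_comp _ _ _ bl)/le_cvgn_seq.
Qed.

(** A shift of indices by at most s costs at most s consecutive increments. *)
Lemma cvg_bounded_shift (R : realFieldType) (V : normedModType R)
    (y : nat -> V) (s : nat) (n : nat -> nat) :
  (y k.+1 - y k) @[k --> \oo] --> 0 -> (forall k, (k <= n k <= k + s)%N) ->
  (y (n k) - y k) @[k --> \oo] --> 0.
Proof.
move=> dy nk; pose E s k := \sum_(j < s) `|y (k + j).+1 - y (k + j)%N|.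
have E0 t : E t k @[k --> \oo] --> 0.
  elim: t => [|t IH].
    by rewrite /E; under eq_fun do rewrite big_ord0; exact: cvg_cst.
  have dt : `|y (k + t).+1 - y (k + t)%N| @[k --> \oo] --> 0.
    rewrite -(@normr0 _ V); apply: cvg_norm.
    apply: (cvg_comp (fun k => (k + t)%N) (fun k => y k.+1 - y k) _ dy).
    by apply: le_cvgn_seq => k; exact: leq_addr.
  have -> : E t.+1 = E t \+ (fun k => `|y (k + t).+1 - y (k + t)%N|).
    by apply/funext => k; rewrite /E big_ord_recr.
  by apply: cvg_trans (cvgD IH dt) _; rewrite addr0.
have yE l k : `|y (k + l)%N - y k| <= E l k.
  elim: l => [|l IH]; first by rewrite addn0 subrr normr0 /E big_ord0.
  rewrite /E big_ord_recr /= addnS -(subrKA (y (k + l)%N)) [leRHS]addrC.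
  by rewrite (le_trans (ler_normD _ _))// lerD2l.
apply: (cvg0_norm_le _ (E0 s)) => k.
have /andP[kn nks] := nk k; rewrite -(subnKC kn).
apply: le_trans (yE _ _) _; rewrite /E.
have ls : (n k - k <= s)%N by rewrite leq_subLR.
by rewrite (big_ord_widen _ (fun j => `|y (k + j).+1 - y (k + j)%N|) ls) big_mkcond;
  apply: ler_sum => j _; case: ifP.
Qed.

(** * Distance to a set and norm convergence *)

Section Dist.
Variables (R : realType) (H : completeNormedModType R).
Implicit Types (x y z : H) (A : set H).

Lemma dist_has_inf x A : A !=set0 -> has_inf [set `|x - z| | z in A].
Proof. by move=> [z Az]; split; [exists `|x - z|, z|exists 0 => _ [u _ <-]]. Qed.

Lemma dist_ge0 x A : A !=set0 -> 0 <= dist x A.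
Proof.
by move=> [z Az]; apply: lb_le_inf => [|_ [u _ <-]//]; exists `|x - z|, z.
Qed.

Lemma dist_le x A z : A z -> dist x A <= `|x - z|.
Proof. by move=> Az; apply: ge_inf; [exists 0 => _ [u _ <-]|exists z]. Qed.

Lemma dist_lt x A d : A !=set0 -> dist x A < d -> exists2 z, A z & `|x - z| < d.
Proof.
move=> A0; rewrite -subr_gt0 => e0.
have [_ [z Az <-]] := inf_adherent e0 (dist_has_inf x A0).
by rewrite -/(dist x A) subrKC => ?; exists z.
Qed.

Lemma dist_triangle x y A : A !=set0 -> dist x A <= `|x - y| + dist y A.
Proof.
move=> A0; rewrite -lerBlDl; apply: lb_le_inf; first exact: (dist_has_inf y A0).1.
move=> _ [z Az <-]; rewrite lerBlDl; apply: le_trans (dist_le x Az) _.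
exact: ler_distD.
Qed.

End Dist.

Section Step.
Variables (R : realType) (H : completeNormedModType R).
Variable dot : {dot H for idfun}.
Hypothesis Hdot : induces_norm dot.
Implicit Types (u v w h x z : H) (Q : set H).

(** The constant c is the same for all z in A. Hence if x_k is within e / 4 of
    some z in A and the remaining errors sum to less than e^2 / 16, then x_n
    stays within e / 2 of z for all n >= k; by weak lower semicontinuity so
    does l. *)
Lemma fejer_dist_cvg (A : set H) (x : nat -> H) (r : nat -> R) (c : R) (l : H) :
  0 <= c -> (forall k, 0 <= r k) -> A !=set0 ->
  (forall z, A z -> forall k, `|x k.+1 - z| ^+ 2 <= `|x k - z| ^+ 2 + c * r k) ->
  cvgn (series r) -> weak_cvg dot x l ->
  (fun k => dist (x k) A) @ \oo --> 0 -> x @ \oo --> l.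
Proof.
move=> c0 r0 A0 step /cvg_ex[S rS] xl dA.
have fej z k n : A z -> (k <= n)%N ->
    `|x n - z| ^+ 2 <= `|x k - z| ^+ 2 + c * (S - series r k).
  move=> Az kn.
  have h : `|x n - z| ^+ 2 <= `|x k - z| ^+ 2 + c * (series r n - series r k).
    elim: n kn => [|n IH].
      by rewrite leqn0 => /eqP->; rewrite subrr mulr0 addr0.
    rewrite leq_eqVlt => /predU1P[<-|]; first by rewrite subrr mulr0 addr0.
    rewrite ltnS => /IH; have := step _ Az n.
    by rewrite /series /= big_nat_recr//=; lra.
  apply: le_trans h _; rewrite lerD2l ler_wpM2l// lerD2r.
  have Snd : nondecreasing_seq (series r).
    by apply/nondecreasing_seqP => j; rewrite /series /= big_nat_recr//= lerDl.
  have -> : S = limn (series r) by apply/esym/cvg_lim.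
  by apply: nondecreasing_cvgn_le => //; apply/cvg_ex; exists S.
apply/cvgrPdist_lt => e e0.
have e4 : 0 < e / 4 by rewrite divr_gt0.
have e16 : 0 < e ^+ 2 / 16 by rewrite divr_gt0// exprn_gt0.
have cS0 : c * (S - series r k) @[k --> \oo] --> 0.
  rewrite -(mulr0 c) -(subrr S); apply: cvgMl_tmp.
  by apply: cvgB => //; exact: cvg_cst.
near \oo => k.
have dk : dist (x k) A < e / 4.
  near: k; move/cvgrPdist_lt: dA => /(_ _ e4); apply: filterS => k.
  by rewrite sub0r normrN => /ltr_normlW.
have ck : c * (S - series r k) < e ^+ 2 / 16.
  near: k; move/cvgrPdist_lt: cS0 => /(_ _ e16); apply: filterS => k.
  by rewrite sub0r normrN => /ltr_normlW.
have [z Az xz] := dist_lt A0 dk.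
have xz2 : `|x k - z| ^+ 2 < e ^+ 2 / 16.
  have -> : e ^+ 2 / 16 = (e / 4) ^+ 2 by field.
  by rewrite ltr_sqr ?nnegrE// ltW.
have xn n : (k <= n)%N -> `|x n - z| < e / 2.
  move=> kn; rewrite -ltr_sqr ?nnegrE// ?divr_ge0// ?ltW//.
  have -> : (e / 2) ^+ 2 = e ^+ 2 / 4 by field.
  by have := fej z k n Az kn; have := exprn_gt0 2 e0; lra.
have lz : `|l - z| <= e / 2.
  apply: (weak_cvg_norm_le Hdot (weak_cvgB xl)).
  by exists k => // n /= kn; apply: ltW; exact: xn.
exists k => // n /= /xn nz; rewrite -(subrKA z).
by rewrite (le_lt_trans (ler_normD _ _))// [e]splitr ler_ltD// distrC.
Unshelve. all: by end_near.
Qed.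

(** * One step of the method *)

Lemma dot_sumr (I : finType) (J : {set I}) u (v : I -> H) :
  dot u (\sum_(i in J) v i) = \sum_(i in J) dot u (v i).
Proof. exact: raddf_sum. Qed.

(** Jensen's inequality for the squared norm: sum the inequalities
    |v_i|^2 >= 2 <V, v_i> - |V|^2, where V is the mean of the v_i. *)
Lemma sqr_norm_convex (I : finType) (J : {set I}) (w : I -> R) (v : I -> H) :
  (forall i, i \in J -> 0 <= w i) -> \sum_(i in J) w i = 1 ->
  `|\sum_(i in J) w i *: v i| ^+ 2 <= \sum_(i in J) w i * `|v i| ^+ 2.
Proof.
move=> w0 w1; set V := \sum_(i in J) _.
have VV : \sum_(i in J) w i * dot V (v i) = `|V| ^+ 2.
  rewrite -Hdot -[RHS]/(dot V (\sum_(i in J) w i *: v i)) dot_sumr.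
  by apply: eq_bigr => i _; rewrite dotZr.
have : \sum_(i in J) w i * (2 * dot V (v i) - `|V| ^+ 2) <=
    \sum_(i in J) w i * `|v i| ^+ 2.
  apply: ler_sum => i iJ; apply: ler_wpM2l; first exact: w0.
  have : 0 <= `|V - v i| ^+ 2 by rewrite exprn_ge0.
  by rewrite (sqr_normB Hdot); lra.
under eq_bigr do rewrite mulrBr mulrCA.
by rewrite sumrB -mulr_sumr -mulr_suml w1 VV; lra.
Qed.

(** The form of the cutter inequality that the step estimates use: a cutter
    moves x towards every fixed point z. *)
Lemma cutter_dot (T : H -> H) x z : cutter dot T -> fixpts T z ->
  `|T x - x| ^+ 2 <= dot (T x - x) (z - x).
Proof.
move=> [_ /(_ x z)] + Tz => /(_ Tz); rewrite -Hdot.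
have -> : z - T x = (z - x) - (T x - x) by rewrite opprB addrA subrK.
have -> : x - T x = - (T x - x) by rewrite opprB.
rewrite dotNr dotBl [dot _ (T x - x)]dotC; lra.
Qed.

Lemma cutter_le (T : H -> H) x z : cutter dot T -> fixpts T z ->
  `|T x - x| <= `|z - x|.
Proof.
move=> cT Tz; have := le_trans (cutter_dot x cT Tz) (dot_le Hdot _ _).
have [->|d0] := eqVneq (T x - x) 0; first by rewrite normr0.
by rewrite expr2 ler_pM2l// normr_gt0.
Qed.

Lemma overrelax_norm (r : R) (phi : H -> R) (T : H -> H) x :
  0 <= r -> 0 < phi x ->
  0 <= overrelax r phi T x /\
  overrelax r phi T x * `|T x - x| =
    if T x == x then 0 else r / phi x + `|T x - x|.
Proof.
move=> r0 p0; rewrite /overrelax; case: eqVneq => [_|Tx]; first by rewrite mul0r.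
have d0 : 0 < `|T x - x| by rewrite normr_gt0 subr_eq0.
rewrite divfK ?gt_eqF// divr_ge0 ?addr_ge0// divr_ge0//; exact: ltW.
Qed.

(** Let d = |T x - x| and rho = r / phi x. If d > 0, the step has length
    a (d + rho), so the left-hand side is at most
    |x - z|^2 - 2 a (d + rho) d + a^2 (d + rho)^2. The terms in d^2 combine to - a (2 - a) d^2 <= - e^2 d^2, and all others
    carry a factor rho and are absorbed by the error term, as 0 <= a <= 2. *)
Lemma overrelaxed_cutter_step (r : R) (phi : H -> R) (T : H -> H) x z (a e : R) :
  cutter dot T -> fixpts T z -> 0 <= r -> 0 < phi x -> 0 < e -> e <= a <= 2 - e ->
  `|x + (a * overrelax r phi T x) *: (T x - x) - z| ^+ 2 <=
  `|x - z| ^+ 2 - e ^+ 2 * `|T x - x| ^+ 2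
    + 4 * (r / phi x) * (`|T x - x| + r / phi x).
Proof.
move=> cT Tz r0 p0 e0 /andP[ea a2].
have rho0 : 0 <= r / phi x by rewrite divr_ge0// ltW.
have [b0 bd] := overrelax_norm T r0 p0.
have := cutter_dot x cT Tz; move: bd b0 rho0.
set b := overrelax _ _ _ _; set rho := r / _; case: eqVneq => [->|_ bd b0 rho0].
  by rewrite subrr normr0 scaler0 addr0 => _ _ rho0 _; rewrite expr0n /=; nra.
set u := T x - x in bd *; set d := `|u| in bd * => ud.
rewrite [x + _ - z]addrAC [leLHS](sqr_normD Hdot) dotZr normrZ exprMn.
rewrite real_normK ?num_real//.
rewrite -/d [dot _ u]dotC -(opprB z x) dotNr normrN.
have d0 : 0 <= d by exact: normr_ge0.
have ab0 : 0 <= a * b by rewrite mulr_ge0//; lra.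
have h1 : (a * b) * d ^+ 2 <= (a * b) * dot u (z - x) by rewrite ler_wpM2l.
have h2 : (a * b) * d ^+ 2 = a * (rho + d) * d by rewrite -bd; ring.
have h3 : (a * b) ^+ 2 * d ^+ 2 = a ^+ 2 * (rho + d) ^+ 2 by rewrite -bd; ring.
have h4 : e ^+ 2 * d ^+ 2 <= (a * (2 - a)) * d ^+ 2.
  by apply: ler_wpM2r; rewrite ?exprn_ge0// expr2; apply: ler_pM; lra.
have [a0 a_le2] : 0 <= a /\ a <= 2 by lra.
have h5 : (a ^+ 2 - a) * (rho * d) <= 2 * (rho * d).
  by apply: ler_wpM2r; [exact: mulr_ge0|nra].
have h6 : a ^+ 2 * rho ^+ 2 <= 4 * rho ^+ 2.
  by apply: ler_wpM2r; [exact: exprn_ge0|nra].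
by rewrite h3; lra.
Qed.

(** The iterate before projection is the convex combination, with weights w_i,
    of the single-operator steps, so [overrelaxed_cutter_step] averages; one
    power of e in the gain e^3 comes from the lower bound on the weights. The
    second bound holds because x itself lies in Q, so projecting does not
    increase the displacement either. *)
Lemma simultaneous_step (m : nat) (J : {set 'I_m}) (T : 'I_m -> H -> H) (Q : set H)
    (w : 'I_m -> R) (phi : 'I_m -> H -> R) (r a e delta N : R) x z :
  closed Q -> convex_set Q -> Q x -> Q z ->
  (forall i, cutter dot (T i)) -> (forall i, fixpts (T i) z) ->
  0 <= r -> 0 < delta -> (forall i, delta <= phi i x) ->
  0 < e -> e <= a <= 2 - e ->
  (forall i, i \in J -> e <= w i <= 1) -> \sum_(i in J) w i = 1 ->
  (forall i, `|T i x - x| <= N) ->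
  let x' := metric_proj Q (x + a *:
    \sum_(i in J) (w i * overrelax r (phi i) (T i) x) *: (T i x - x)) in
  `|x' - z| ^+ 2 + e ^+ 3 * \sum_(i in J) `|T i x - x| ^+ 2
    <= `|x - z| ^+ 2 + 4 * (r / delta) * (N + r / delta) /\
  `|x' - x| <= 2 * (r / delta + \sum_(i in J) `|T i x - x|).
Proof.
move=> clQ cvQ Qx Qz cT Tz r0 delta0 phid e0 ea we w1 dN /=.
have phi0 i : 0 < phi i x by exact: lt_le_trans (phid i).
have rhod i : r / phi i x <= r / delta.
  by rewrite ler_wpM2l// lef_pV2// posrE.
have rho0 i : 0 <= r / phi i x by rewrite divr_ge0// ltW.
have w0 i : i \in J -> 0 <= w i by move=> /we/andP[ew _]; lra.
set y := x + _.
split.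
  rewrite -lerBrDr; apply: le_trans (_ : `|y - z| ^+ 2 <= _).
    by rewrite ler_sqr ?nnegrE// (metric_proj_le Hdot).
  pose yi i := x + (a * overrelax r (phi i) (T i) x) *: (T i x - x) - z.
  have -> : y - z = \sum_(i in J) w i *: yi i.
    rewrite /yi; under [RHS]eq_bigr do rewrite addrAC scalerDr.
    rewrite big_split /= -scaler_suml w1 scale1r /y addrAC; congr +%R.
    rewrite scaler_sumr; apply: eq_bigr => i _.
    by rewrite !scalerA; congr (_ *: _); ring.
  apply: le_trans (sqr_norm_convex _ w0 w1) _.
  have -> : `|x - z| ^+ 2 + 4 * (r / delta) * (N + r / delta) -
      e ^+ 3 * \sum_(i in J) `|T i x - x| ^+ 2 =
    \sum_(i in J) (w i * (`|x - z| ^+ 2 + 4 * (r / delta) * (N + r / delta)) -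
      e ^+ 3 * `|T i x - x| ^+ 2).
    by rewrite sumrB -mulr_suml w1 mul1r mulr_sumr.
  apply: ler_sum => i iJ; have /andP[ewi _] := we i iJ.
  have h1 := ler_wpM2l (w0 i iJ)
    (overrelaxed_cutter_step (cT i) (Tz i) r0 (phi0 i) e0 ea).
  apply: le_trans h1 _.
  have h2 : r / phi i x * (`|T i x - x| + r / phi i x) <=
      r / delta * (N + r / delta).
    by rewrite ler_pM ?addr_ge0// lerD.
  have h3 := ler_wpM2l (w0 i iJ) h2.
  have h4 : e * (e ^+ 2 * `|T i x - x| ^+ 2) <=
      w i * (e ^+ 2 * `|T i x - x| ^+ 2).
    by rewrite ler_wpM2r// mulr_ge0// exprn_ge0// ltW.
  by move: h3 h4; rewrite -!(mulrA 4) !mulrDr !mulrN !(mulrCA _ 4) exprS mulrA; lra.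
apply: le_trans (metric_proj_le Hdot _ clQ cvQ Qx) _.
rewrite /y addrAC subrr add0r normrZ gtr0_norm; last by lra.
have a2 : a <= 2 by lra.
rewrite ler_pM//; first by lra.
apply: le_trans (ler_norm_sum _ _ _) _.
rewrite -[r / delta]mul1r -w1 mulr_suml -big_split /=.
apply: ler_sum => i iJ; have /andP[_ wi1] := we i iJ.
have [b0 bd] := overrelax_norm (T i) r0 (phi0 i).
rewrite normrZ ger0_norm ?mulr_ge0// ?w0// -mulrA bd.
have wd : w i * `|T i x - x| <= `|T i x - x| by rewrite ler_piMl.
have wr := ler_wpM2l (w0 i iJ) (rhod i).
case: eqP => [_|_]; last by rewrite mulrDr lerD.
by rewrite mulr0 addr_ge0// mulr_ge0// ?w0// divr_ge0// ltW.
Qed.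

End Step.

Lemma intermittent_hit (m s : nat) (Ik : nat -> {set 'I_m}) :
  intermittent s Ik -> forall i, exists n : nat -> nat, forall k,
    (k <= n k <= k + s)%N /\ i \in Ik (n k).
Proof.
move=> hI i.
suff /choice[n hn] : forall k, exists n, (k <= n <= k + s)%N /\ i \in Ik n.
  by exists n.
move=> k; have : i \in (\bigcup_(l < s.+1) Ik (k + l)%N)%SET.
  by rewrite hI finset.inE.
move=> /finset.bigcupP[l _ il]; exists (k + l)%N; split=> //.
by rewrite leq_addr leq_add2l -ltnS ltn_ord.
Qed.

(** Each term is at most the square root of the sum of squares, and there are at
    most m terms, whatever the index set I_k is. *)
Lemma sum_of_squares_cvg0 (R : realType) (m : nat) (Ik : nat -> {set 'I_m})
    (d : 'I_m -> nat -> R) : (forall j k, 0 <= d j k) ->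
  \sum_(j in Ik k) d j k ^+ 2 @[k --> \oo] --> 0 ->
  \sum_(j in Ik k) d j k @[k --> \oo] --> 0.
Proof.
move=> d0 D0; pose D k := \sum_(j in Ik k) d j k ^+ 2.
have sD : m%:R * Num.sqrt (D k) @[k --> \oo] --> 0.
  rewrite -(mulr0 m%:R) -(@sqrtr0 R); apply: cvgMl_tmp.
  by apply: (cvg_comp D Num.sqrt D0); exact: sqrt_continuous.
apply: (cvg0_norm_le _ sD) => k; rewrite ger0_norm ?sumr_ge0//.
have dD j : j \in Ik k -> d j k <= Num.sqrt (D k).
  move=> jk; rewrite -[d j k]ger0_norm// -sqrtr_sqr ler_wsqrtr//.
  by rewrite /D (bigD1 j)//= lerDl sumr_ge0// => *; rewrite exprn_ge0.
apply: le_trans (ler_sum _ dD) _.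
rewrite sumr_const -[leLHS]mulr_natl ler_wpM2r ?sqrtr_ge0// ler_nat.
by rewrite -[leqRHS](card_ord m) max_card.
Qed.

(** * The convergence theorem *)

Theorem theorem4p1
  (R : realType) (H : completeNormedModType R) (dot : {dot H for idfun})
  (Hdot : induces_norm dot)
  (m : nat) (Hm : (1 <= m)%N)
  (T : 'I_m -> H -> H) (HT : forall i, cutter dot (T i))
  (C : set H) (HC : C = \bigcap_i fixpts (T i))
  (Q : set H) (Qclosed : closed Q) (Qconvex : convex_set Q)
  (r : nat -> R) (Hr : forall k, 0 < r k)
  (phi : 'I_m -> H -> R) (Hphi : forall i x, 0 < phi i x)
  (alpha : nat -> R) (Halpha : forall k, 0 < alpha k < 2)
  (Ik : nat -> {set 'I_m}) (HIk : forall k, Ik k != finset.set0)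
  (lambda : 'I_m -> nat -> R)
  (Hlambda : forall k i, i \in Ik k -> 0 < lambda i k <= 1)
  (Hlambda1 : forall k, \sum_(i in Ik k) lambda i k = 1)
  (x : nat -> H) (Hx0 : Q (x 0%N))
  (Hx : forall k, x k.+1 = metric_proj Q
     (x k + alpha k *: \sum_(i in Ik k)
        (lambda i k * overrelax (r k) (phi i) (T i) (x k)) *: (T i (x k) - x k)))
  (Hi : C `&` Q !=set0)
  (Hii : cvgn (series r))
  (Hiii : forall S : set H, bounded_set S ->
     exists delta Delta : R, [/\ 0 < delta, 0 < Delta &
       forall y i, S y -> delta <= phi i y <= Delta])
  (Hiv : exists2 eps : R, 0 < eps & forall k,
     (forall i, i \in Ik k -> eps <= lambda i k <= 1) /\
     eps <= alpha k <= 2 - eps)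
  (Hv : exists2 s : nat, (1 <= s)%N & intermittent s Ik)
  (Hvi : forall i, weakly_regular dot (T i))
  (Hbounded : bounded_fun x) :
  exists2 xoo : H, (C `&` Q) xoo &
    weak_cvg dot x xoo /\
    ((forall i, boundedly_regular (T i)) /\
     boundedly_regular_family (adjoin Q (fun i => fixpts (T i))) ->
     x @ \oo --> xoo).
Proof.
have [M xM] := (bounded_funE x).1 Hbounded.
(* A fixed solution z0 bounds all displacements |T_i x_k - x_k|, so that the
   constant c below serves every solution z. *)
have [z0 [Cz0 Qz0]] := Hi.
have CT z : C z -> forall i, fixpts (T i) z by rewrite HC => Cz i; exact: Cz.
have Qx k : Q (x k).
  case: k => // k; rewrite Hx; set y := x k + _.
  by have [] := metric_projP Hdot y Qclosed Qconvex (ex_intro _ _ Qz0).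
have [delta [Delta [delta0 _ phid]]] : exists delta Delta : R,
    [/\ 0 < delta, 0 < Delta & forall y i, range x y -> delta <= phi i y <= Delta].
  apply: Hiii; case: Hbounded => B [Breal xB].
  by exists B; split => // b Bb _ [k _ <-]; exact: xB.
have {}phid i k : delta <= phi i (x k).
  by have /andP[] := phid (x k) i (ex_intro2 _ _ k I erefl).
have r0 k : 0 <= r k by exact: ltW.
have r_cvg0 : r @ \oo --> 0 by exact: cvg_series_cvg_0.
have [B rB] := (bounded_funE r).1 (cvg_seq_bounded (cvgP _ r_cvg0)).
have [eps eps0 weight] := Hiv.
pose d i k := `|T i (x k) - x k|.
pose N := M + `|z0|.
have dN i k : d i k <= N.
  apply: le_trans (cutter_le Hdot (x k) (HT i) (CT _ Cz0 i)) _.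
  by rewrite [leRHS]addrC (le_trans (ler_normB _ _))// lerD2l.
have N0 : 0 <= N by rewrite addr_ge0// (le_trans _ (xM 0%N)).
have B0 : 0 <= B by rewrite (le_trans _ (rB 0%N)).
pose c := 4 / delta * (N + B / delta).
have c0 : 0 <= c.
  by apply: mulr_ge0; [exact: divr_ge0 (ler0n _ _) (ltW delta0)|
    exact: addr_ge0 N0 (divr_ge0 B0 (ltW delta0))].
have step z k : (C `&` Q) z ->
    `|x k.+1 - z| ^+ 2 + eps ^+ 3 * \sum_(i in Ik k) d i k ^+ 2
      <= `|x k - z| ^+ 2 + c * r k /\
    `|x k.+1 - x k| <= 2 * (r k / delta + \sum_(i in Ik k) d i k).
  move=> [Cz Qz]; have [wk ak] := weight k.
  have [h1 h2] := simultaneous_step Hdot Qclosed Qconvex (Qx k) Qz HT (CT _ Cz)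
    (r0 k) delta0 (fun i => phid i k) eps0 ak wk (Hlambda1 k) (fun i => dN i k).
  rewrite -Hx in h1 h2; split; last exact: h2.
  apply: le_trans h1 _; rewrite lerD2l /c.
  have -> : 4 / delta * (N + B / delta) * r k =
      4 * (r k / delta) * (N + B / delta) by ring.
  have rd : 0 <= r k / delta by exact: divr_ge0 (r0 k) (ltW delta0).
  apply: ler_wpM2l; first exact: mulr_ge0.
  rewrite lerD2l ler_pM2r ?invr_gt0//.
  exact: le_trans (ler_norm _) (rB k).
have D0 k : 0 <= eps ^+ 3 * \sum_(i in Ik k) d i k ^+ 2.
  apply: mulr_ge0; first by rewrite exprn_ge0// ltW.
  by apply: sumr_ge0 => i _; apply: exprn_ge0; exact: normr_ge0.
have fejer z : (C `&` Q) z -> cvgn (fun k => `|x k - z| ^+ 2) /\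
    eps ^+ 3 * \sum_(i in Ik k) d i k ^+ 2 @[k --> \oo] --> 0.
  move=> CQz; apply: (@quasi_fejer_cvg _ (fun k => `|x k - z| ^+ 2)
    (fun k => eps ^+ 3 * \sum_(i in Ik k) d i k ^+ 2) r c _ _ _ Hii) => k.
  - by rewrite exprn_ge0.
  - exact: D0.
  - by have [] := step z k CQz.
have d0 : \sum_(i in Ik k) d i k @[k --> \oo] --> 0.
  apply: sum_of_squares_cvg0 => [j k|]; first exact: normr_ge0.
  have [_ D_cvg0] := fejer z0 (conj Cz0 Qz0).
  have e3 : eps ^+ 3 != 0 by rewrite gt_eqF// exprn_gt0.
  rewrite (_ : (fun k => _) =
      (fun k => (eps ^+ 3)^-1 * (eps ^+ 3 * \sum_(i in Ik k) d i k ^+ 2))).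
    apply: cvg_trans (@cvgMl_tmp _ _ _ _ _ (eps ^+ 3)^-1 _ D_cvg0) _.
    by rewrite mulr0.
  by apply/funext => k; rewrite mulKf.
have dx : (x k.+1 - x k) @[k --> \oo] --> 0.
  apply: (@cvg0_norm_le _ _
    (fun k => 2 * (r k / delta + \sum_(i in Ik k) d i k))) => [k|].
    by have [] := step z0 k (conj Cz0 Qz0).
  apply: cvg_trans (@cvgMl_tmp _ _ _ _ _ 2 _
    (cvgD (@cvgMr_tmp _ _ _ _ _ _ delta^-1 r_cvg0) d0)) _.
  by rewrite mul0r addr0 mulr0.
have [s _ hs] := Hv.
(* Near any time k there is a time n k at which i is active. *)
have near_regular i : exists n : nat -> nat,
    [/\ forall k, (k <= n k)%N, (x (n k) - x k) @[k --> \oo] --> 0 &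
        (T i (x (n k)) - x (n k)) @[k --> \oo] --> 0].
  have [n hn] := intermittent_hit hs i; exists n; split.
  - by move=> k; have [/andP[]] := hn k.
  - by apply: (cvg_bounded_shift (s := s) dx) => k; have [] := hn k.
  - have n_oo : n @ \oo --> \oo by apply: le_cvgn_seq => k; have [/andP[]] := hn k.
    apply: (cvg0_norm_le _ (cvg_comp _ _ n_oo d0)) => k /=.
    rewrite (bigD1 i) ?(hn k).2//= -/(d i (n k)) lerDl.
    by apply: sumr_ge0 => j _; exact: normr_ge0.
have [xoo Cxoo xw] : exists2 xoo, (C `&` Q) xoo & weak_cvg dot x xoo.
  apply: (opial Hdot xM) => [z /fejer[]//|f l fi xl]; split.
    rewrite HC => i _; have [n [nk xn Tn]] := near_regular i.
    have f_oo := increasing_seq_cvg fi.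
    apply: (Hvi i (fun k => x (n (f k)))).
      apply: (weak_cvg_perturb Hdot xl).
      exact: (cvg_comp f (fun k => x (n k) - x k) f_oo xn).
    exact: (cvg_comp f (fun k => T i (x (n k)) - x (n k)) f_oo Tn).
  by apply: (weak_cvg_closed Hdot Qclosed Qconvex _ xl) => k; exact: Qx.
exists xoo => //; split => // -[breg bfam].
apply: (fejer_dist_cvg Hdot c0 r0 Hi _ Hii xw) => [z CQz k|].
  by have [h _] := step z k CQz; apply: le_trans h; rewrite lerDl.
pose A := adjoin Q (fun i => fixpts (T i)).
have AE : \bigcap_j A j = C `&` Q.
  rewrite HC; apply/seteqP; split=> [z Az|z [Cz Qz] [i|] _]; last by [].
    by split=> [i _|]; [exact: (Az (Some i))|exact: (Az None)].
  exact: Cz.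
have A0 j : A j !=set0.
  by case: j => [i|]; [have [] := HT i|exists z0].
have distA j : dist (x k) (A j) @[k --> \oo] --> 0.
  case: j => [i|] /=; last first.
    apply: (@cvg0_norm_le _ _ (fun=> 0)) => [k|]; last exact: cvg_cst.
    rewrite ger0_norm ?dist_ge0//; last by exists z0.
    by apply: le_trans (dist_le _ (Qx k)) _; rewrite subrr normr0.
  have [n [nk xn Tn]] := near_regular i.
  have dn : dist (x (n k)) (fixpts (T i)) @[k --> \oo] --> 0.
    apply: (breg i (fun k => x (n k))).
      by apply/bounded_funE; exists M => k; exact: xM.
    by rewrite -(@normr0 _ H); apply: cvg_norm.
  apply: (@cvg0_norm_le _ _ (fun k =>
    `|x (n k) - x k| + dist (x (n k)) (fixpts (T i)))) => [k|].
    rewrite ger0_norm; last exact: dist_ge0 (A0 (Some i)).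
    rewrite distrC.
    exact: dist_triangle (A0 (Some i)).
  by apply: cvg_trans (cvgD (cvg_norm xn) dn) _; rewrite normr0 addr0.
rewrite -AE; apply: bfam => //.
apply/cvgrPdist_lt => e e0; have e2 : 0 < e / 2 by rewrite divr_gt0.
have : \forall k \near \oo, forall j, dist (x k) (A j) < e / 2.
  apply: filter_forall => j; move/cvgrPdist_lt: (distA j) => /(_ _ e2).
  by apply: filterS => k; rewrite sub0r normrN => /ltr_normlW.
apply: filterS => k small; rewrite sub0r normrN.
have sup_le : sup (range (fun j => dist (x k) (A j))) <= e / 2.
  apply: ge_sup; first by exists (dist (x k) (A None)), None.
  by move=> _ [j _ <-]; exact: ltW.
have sup_ge0 : 0 <= sup (range (fun j => dist (x k) (A j))).
  apply: le_trans (dist_ge0 (x k) (A0 None)) _.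
  apply: ub_le_sup; last by exists None.
  by exists (e / 2) => _ [j _ <-]; exact: ltW.
by rewrite ger0_norm//; lra.
Qed.
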